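(* Let $L\in\mathbb{R}^{n\times n}$ be a Laplacian matrix and let $\bar J=(\bar J_{ij})_{n\times n}=L^\vdash$ be its eigenprojection. For every $\delta>0$ let $\boldsymbol v=\boldsymbol v(\delta)=(v_1,\ldots,v_n)^{\mathrm T}$ be a vector with nonnegative entries, $s=s(\delta)=\sum_{i=1}^n v_i$, such that $\delta/s\to+0$ as $\delta\to+0$ and the limit $\tilde{\boldsymbol v}=\lim_{\delta\to+0}\tfrac1s\boldsymbol v$ exists. For each $\delta$ let $\boldsymbol y(t)=(y_1(t),\ldots,y_{n+1}(t))^{\mathrm T}$, $t\ge0$, be the solution of $$\dot{\boldsymbol{y}}(t)=-(L_0+H_{\delta,\boldsymbol{v}})\,\boldsymbol{y}(t)$$ with initial state $\boldsymbol y(0)\in\mathbb R^{n+1}$ (fixed independently of $\delta$), where $L_0$ and $H_{\delta,\boldsymbol v}$ are defined in the context. Then: 1. $\displaystyle\lim_{\delta\to+0}\lim_{t\to\infty}\boldsymbol{y}(t)=\mathbf 1'\big[\tilde{\boldsymbol v}^{\mathrm T}\bar J\;\;0\big]\boldsymbol y(0)$. 2. If $\boldsymbol v=\tfrac sn\mathbf 1$, then $$\lim_{\delta\to+0}\lim_{t\to\infty}\boldsymbol{y}(t)=\mathbf 1'\big[\tfrac1n\mathbf 1^{\mathrm T}\bar J\;\;0\big]\boldsymbol y(0)=\mathbf 1'\,\frac1n\sum_{j=1}^n\bar J_{\cdot j}\,y_j(0),$$ where $\bar J_{\cdot j}=\sum_{i=1}^n\bar J_{ij}$.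
   Context: A Laplacian matrix is a real square matrix with nonpositive off-diagonal entries and zero row sums. For a square matrix $A$ let $\nu$ be its index, i.e. the smallest $k\in\{0,1,\ldots\}$ with $\operatorname{rank}A^{k+1}=\operatorname{rank}A^k$ (where $A^0=I$); the eigenprojection $A^\vdash$ of $A$ (corresponding to the eigenvalue $0$) is the unique idempotent matrix with range $\mathcal R(A^\vdash)=\mathcal N(A^\nu)$ and null space $\mathcal N(A^\vdash)=\mathcal R(A^\nu)$. $\mathbf 1$ and $\mathbf 0$ are the all-ones and all-zeros column vectors of length $n$, $\mathbf 1'$ is the all-ones column vector of length $n+1$, $I$ is the identity matrix of order $n$. Define the matrices of order $n+1$ $$L_0=\begin{pmatrix}L&\mathbf 0\\ \mathbf 0^{\mathrm T}&0\end{pmatrix},\quad H_I=\begin{pmatrix}I&-\mathbf 1\\ \mathbf 0^{\mathrm T}&0\end{pmatrix},\quad H_{\boldsymbol v}=\begin{pmatrix}0_{n\times n}&\mathbf 0\\ -\boldsymbol v^{\mathrm T}&s\end{pmatrix},\quad H_{\delta,\boldsymbol v}=\delta H_I+H_{\boldsymbol v}.$$ For a row vector $u$ of length $n$ and a scalar $c$, $[u\;\;c]$ is the row vector of length $n+1$ obtained by appending $c$ to $u$. *)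

(* Defs.v *)
From HB Require Import structures.
From mathcomp Require Import all_boot all_order all_algebra.
From mathcomp Require Import all_classical all_reals all_analysis.

Set Implicit Arguments.
Unset Strict Implicit.
Unset Printing Implicit Defensive.

Import Order.TTheory GRing.Theory Num.Theory numFieldNormedType.Exports.

Local Open Scope classical_set_scope.
Local Open Scope ring_scope.

Definition laplacian (R : realType) (n : nat) (L : 'M[R]_n) : Prop :=
  (forall i j, i != j -> L i j <= 0) /\ (forall i, \sum_j L i j = 0).

(* Matrices act on column vectors on the left, so ranges and null spaces are
   sets of columns, not the row spaces of [mxalgebra]. *)
Definition mx_range (R : realType) (m n : nat) (A : 'M[R]_(m, n)) :
  set 'cV[R]_m := range (fun x : 'cV[R]_n => A *m x).

Definition mx_null (R : realType) (m n : nat) (A : 'M[R]_(m, n)) :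
  set 'cV[R]_n := [set x | A *m x = 0].

Lemma mx_index_exists (R : realType) (n : nat) (A : 'M[R]_n) :
  exists k : nat, \rank (A ^+ k.+1) == \rank (A ^+ k).
Proof.
apply: contrapT => noidx.
have le k : (\rank (A ^+ k.+1)%R < \rank (A ^+ k)%R)%N.
  rewrite ltn_neqAle; apply/andP; split.
    by apply/negP => e; apply: noidx; exists k.
  by rewrite exprS mxrankM_maxr.
have bd k : (\rank (A ^+ k)%R + k <= n)%N.
  elim: k => [|k IH]; first by rewrite addn0 rank_leq_row.
  by apply: leq_trans IH; rewrite addnS -addSn leq_add2r.
by have := bd n.+1; rewrite addnS ltnNge leq_addl.
Qed.

Definition mx_index (R : realType) (n : nat) (A : 'M[R]_n) : nat :=
  ex_minn (mx_index_exists A).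

Definition is_eigenproj (R : realType) (n : nat) (A P : 'M[R]_n) : Prop :=
  [/\ P *m P = P,
      mx_range P = mx_null (A ^+ mx_index A) &
      mx_null P = mx_range (A ^+ mx_index A)].

(* The default value 0 is never reached: see [eigenprojP] and
   [eigenproj_unique]. *)
Definition eigenproj (R : realType) (n : nat) (A : 'M[R]_n) : 'M[R]_n :=
  xget 0 [set P | is_eigenproj A P].

Lemma eigenproj_exists (R : realType) (n : nat) (A : 'M[R]_n) :
  exists P, is_eigenproj A P.
Proof.
rewrite /is_eigenproj /mx_index; case: ex_minnP => k /eqP rk _.
have eqA i : (A ^+ (k + i) :=: A ^+ k)%MS.
  elim: i => [|i IH]; first by rewrite addn0.
  have e1 : (A ^+ k.+1 :=: A ^+ k)%MS.
    apply/eqmxP; rewrite -(geq_leqif (mxrank_leqif_eq _)) ?rk //.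
    by rewrite exprS submxMl.
  rewrite addnS exprSr; apply: eqmx_trans (eqmxMr A IH) _.
  by move: e1; rewrite exprSr.
set B := A ^+ k; pose C := B^T.
have rC : \rank (C *m C) = \rank C.
  rewrite -trmx_mul !mxrank_tr.
  by rewrite (_ : B *m B = A ^+ (k + k)) ?(eqA k) // exprD.
have cap0 : (C :&: kermx C)%MS = 0.
  apply/eqP; rewrite -mxrank_eq0 -(eqn_add2l (\rank (C *m C))).
  by rewrite mxrank_mul_ker addn0 rC.
have cap0' : (kermx C :&: C)%MS = 0 by rewrite capmxC.
have full (u : 'rV[R]_n) : (u <= kermx C + C)%MS.
  apply: submx_full; rewrite -col_leq_rank.
  have := mxrank_sum_cap (kermx C) C; rewrite cap0' mxrank0 addn0 => ->.
  by rewrite mxrank_ker subnK // rank_leq_row.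
pose Q := proj_mx (kermx C) C.
exists Q^T; split.
- rewrite -trmx_mul; congr (_^T).
  by apply/row_matrixP => i; rewrite row_mul proj_mx_id // rowE proj_mx_sub.
- apply/seteqP; split => [_ [z _ <-]|x] /=; rewrite /mx_null /=.
    apply: trmx_inj; rewrite !trmx_mul !trmxK trmx0.
    by apply/sub_kermxP; rewrite proj_mx_sub.
  move=> Bx; exists x => //; apply: trmx_inj; rewrite trmx_mul trmxK.
  by apply: proj_mx_id => //; apply/sub_kermxP; rewrite -trmx_mul Bx trmx0.
- apply/seteqP; split => [x|_ [z _ <-]]; rewrite /mx_null /=.
    move=> Qx; have xQ : x^T *m Q = 0.
      by apply: trmx_inj; rewrite trmx_mul trmxK Qx trmx0.
    have := add_proj_mx cap0' (full x^T); rewrite -/Q xQ add0r => e.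
    have /submxP[D eD] : (x^T <= C)%MS by rewrite -e proj_mx_sub.
    by exists D^T => //; apply: trmx_inj; rewrite trmx_mul trmxK -eD.
  apply: trmx_inj; rewrite trmx_mul trmxK trmx_mul trmx0.
  by apply: proj_mx_0 => //; rewrite submxMl.
Qed.

Lemma eigenproj_unique (R : realType) (n : nat) (A P Q : 'M[R]_n) :
  is_eigenproj A P -> is_eigenproj A Q -> P = Q.
Proof.
move=> [PP rP nP] [QQ rQ nQ].
suff PQ (x : 'cV[R]_n) : P *m x = Q *m x.
  by apply/trmx_inj/row_matrixP => i; rewrite -!tr_col !colE PQ.
have : mx_null Q (x - P *m x).
  by rewrite nQ -nP /mx_null /= mulmxBr mulmxA PP subrr.
rewrite /mx_null /= mulmxBr => /eqP; rewrite subr_eq0 => /eqP ->.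
have : mx_range Q (P *m x) by rewrite rQ -rP; exists x.
by case=> z _ <-; rewrite mulmxA QQ.
Qed.

Lemma eigenprojP (R : realType) (n : nat) (A : 'M[R]_n) :
  is_eigenproj A (eigenproj A).
Proof.
by rewrite /eigenproj; case: xgetP => // noP; case: (eigenproj_exists A) => P /noP.
Qed.

Definition vsum (R : realType) (n : nat) (v : 'cV[R]_n) : R := \sum_i v i 0.

Definition L0_mx (R : realType) (n : nat) (L : 'M[R]_n) : 'M[R]_(n + 1) :=
  block_mx L 0 0 0.

Definition HI_mx (R : realType) (n : nat) : 'M[R]_(n + 1) :=
  block_mx 1%:M (- const_mx 1) 0 0.

Definition Hv_mx (R : realType) (n : nat) (v : 'cV[R]_n) : 'M[R]_(n + 1) :=
  block_mx 0 0 (- v^T) (vsum v)%:M.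

Definition Hdv_mx (R : realType) (n : nat) (d : R) (v : 'cV[R]_n) :
  'M[R]_(n + 1) := d *: HI_mx R n + Hv_mx v.

(* [y] is only meaningful on [0, +oo[, so the derivative at 0 is the
   right-hand one. *)
Definition linear_ode_solution (R : realType) (m : nat) (A : 'M[R]_m)
    (y0 : 'cV[R]_m) (y : R -> 'cV[R]_m) : Prop :=
  [/\ y 0 = y0,
      h^-1 *: (y h - y 0) @[h --> 0^'+] --> A *m y 0 &
      forall t : R, 0 < t -> is_derive t 1 y (A *m y t)].

(* Main.v *)
(* For fixed [d], [A := L0 + H_{d,v}] is [d H_I] plus a Laplacian matrix, so
   along a solution of [y' = - A y] the spread of the entries of [y] decays
   like [exp (- d t)]: at a pair realising the maximum of
   [exp (d t) (y_i - y_j)] the derivative is nonpositive. The solution also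
   conserves [w y], where [w] is the left null vector of [A] with entry sum 1,
   hence converges to the constant vector [w y(0)]. Solving [w A = 0] gives,
   with [R_d := d (L + d I)^-1], [w = (d + s)^-1 [v^T R_d, d]].
   The maximum principle for [L + d I] bounds [R_d] by 1 in the sup norm, so
   that [R_d L z = d (z - R_d z)] tends to 0 with [d]. Since [R_d] fixes the
   kernel of [L], this yields both that [L^2] and [L] have the same kernel and
   that [R_d] tends to the eigenprojection of [L]. *)

Require Import Defs.
From HB Require Import structures.
From mathcomp Require Import all_boot all_order all_algebra.
From mathcomp Require Import all_classical all_reals all_analysis.
From mathcomp Require Import ring lra.

Set Implicit Arguments.
Unset Strict Implicit.
Unset Printing Implicit Defensive.

Import Order.TTheory GRing.Theory Num.Theory numFieldNormedType.Exports.

Local Open Scope classical_set_scope.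
Local Open Scope ring_scope.

(** * Maximum principle for finite families of functions of time *)

(** Comparing only with values to the left allows [c] to be the right end of the interval on which
    the maximum is taken. *)
Lemma is_derive_left_max_ge0 (R : realType) (g : R -> R) (a c l : R) :
  a < c -> is_derive c 1 g l -> (forall x, a <= x <= c -> g x <= g c) -> 0 <= l.
Proof.
move=> ac [dg <-] gmax; rewrite ['D_1 g c]cvg_at_leftE; last exact: dg.
apply: limr_ge.
  rewrite -(cvg_at_leftE (fun h => h^-1 *: ((g \o shift c) _ - g c))) //.
  apply: cvg_trans dg; apply: cvg_app.
  by move=> A [e e0 Ae]; exists e => // x xe /ltr0_neq0; exact: Ae.
near=> h.
have h0 : h < 0 by near: h; exact: nbhs_left_lt.
have ah : a - c < h by near: h; apply: nbhs_left_gt; rewrite subr_lt0.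
apply: mulr_le0; first by rewrite invr_le0 ltW.
rewrite subr_le0 [_%:A]mulr1; apply: gmax => /=.
by rewrite -lerBlDr (ltW ah) gerDr ltW.
Unshelve. all: by end_near. Qed.

(* The [f i - e t] have a joint maximum over [I * [0, t]]; at a positive time
   the derivative there would be at most [- e], so it is attained at time 0. *)
Lemma argmax_decreasing_le (R : realType) (I : finType) (f df : I -> R -> R)
    (K : R) :
  (forall i, f i x @[x --> 0^'+] --> f i 0) ->
  (forall i (t : R), 0 < t -> is_derive t 1 (f i) (df i t)) ->
  (forall i (t : R), 0 < t -> (forall j, f j t <= f i t) -> df i t <= 0) ->
  (forall i, f i 0 <= K) ->
  forall i (t : R), 0 <= t -> f i t <= K.
Proof.
move=> f0 fD dfle fK i t; rewrite le_eqVlt => /predU1P[<-//|t0].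
(* With this slope the penalty [e * t] at the target time is exactly the slack [e']. *)
apply/ler_addgt0Pr => e' e'0; pose e := e' / t.
have e0 : 0 < e by rewrite divr_gt0.
pose g j x := f j x - e * x.
have gD j (x : R) : 0 < x -> is_derive x 1 (g j) (df j x - e).
  move=> x0; have := fD j x x0 => fDx.
  have -> : g j = f j - (e \*: (@id R)) by [].
  by apply: is_derive_eq; rewrite [_%:A]mulr1.
have gct j : {within `[0, t], continuous (g j)}.
  apply/continuous_within_itvP => //; split.
  - move=> x /[!in_itv]/= /andP[x0 _].
    by apply: differentiable_continuous; apply/derivable1_diffP;
      have [] := gD j x x0.
  - by apply: cvgB => //; apply: cvgM; [exact: cvg_cst|];
      apply: cvg_at_right_filter; exact: cvg_id.
  - apply: cvg_at_left_filter.
    by apply: differentiable_continuous; apply/derivable1_diffP;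
      have [] := gD j t t0.
have /choice[c cP] j : exists c : R, c \in `[0, t]%R /\
    forall x : R, x \in `[0, t]%R -> g j x <= g j c.
  by have [c ? ?] := EVT_max (ltW t0) (gct j); exists c.
pose k := [arg max_(j > i) g j (c j)]%O.
have kP j : g j (c j) <= g k (c k).
  by rewrite /k; case: arg_maxP => //= k' _; apply.
have gmax j (x : R) : x \in `[0, t]%R -> g j x <= g k (c k).
  by move=> xt; apply: le_trans (kP j); exact: (cP j).2.
have -> : f i t = g i t + e' by rewrite /g /e divfK ?subrK // gt_eqF.
rewrite lerD2r; apply: (le_trans (gmax i t _)).
  by rewrite in_itv/= lexx ltW.
have := (cP k).1; rewrite in_itv/= => /andP[].
rewrite le_eqVlt => /predU1P[<- _|ck0 ckt]; first by rewrite /g mulr0 subr0.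
have : 0 <= df k (c k) - e.
  apply: (is_derive_left_max_ge0 ck0 (gD k _ ck0)) => x /andP[x0 xc].
  by apply: gmax; rewrite in_itv/= x0 (le_trans xc).
(* The penalty depends on time alone, so [k] also maximises [f] itself at time [c k]. *)
have : df k (c k) <= 0.
  apply: dfle => // j; rewrite -(lerD2r (- (e * c k))).
  by apply: gmax; rewrite in_itv/= (ltW ck0).
lra.
Qed.

(** * Maximum principle for Laplacian matrices *)

(** Zero row sums allow [x j] to be replaced by [x j - x i]; the off-diagonal terms are then
    products of two nonpositive numbers. *)
Lemma laplacian_mul_argmax (R : realType) (n : nat) (L : 'M[R]_n)
    (x : 'cV[R]_n) (i : 'I_n) :
  laplacian L -> (forall j, x j 0 <= x i 0) -> 0 <= (L *m x) i 0.
Proof.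
move=> [L_le0 L0] xi.
have -> : (L *m x) i 0 = \sum_j L i j * (x j 0 - x i 0).
  under [RHS]eq_bigr do rewrite mulrBr.
  by rewrite sumrB -mulr_suml L0 mul0r subr0 mxE.
apply: sumr_ge0 => j _; have [->|ij] := eqVneq i j.
  by rewrite subrr mulr0.
by apply: mulr_le0; [exact: L_le0 | rewrite subr_le0].
Qed.

(** At an index where [x] is largest the Laplacian term is nonnegative, so the shift term alone is
    already at most [K] there. *)
Lemma laplacian_shift_max (R : realType) (n : nat) (L : 'M[R]_n)
    (d K : R) (x : 'cV[R]_n) :
  laplacian L -> 0 < d ->
  (forall i, ((L + d%:M) *m x) i 0 <= K) -> forall i, d * x i 0 <= K.
Proof.
move=> hL d0 xK i.
pose k := [arg max_(j > i) x j 0]%O.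
have kP j : x j 0 <= x k 0 by rewrite /k; case: arg_maxP => //= k' _; apply.
apply: (@le_trans _ _ (d * x k 0)); first by rewrite ler_pM2l.
apply: le_trans (xK k).
rewrite mulmxDl mul_scalar_mx [leRHS]mxE [X in _ + X]mxE lerDr.
exact: laplacian_mul_argmax.
Qed.

(** The previous bound with [K = 0], applied to a kernel vector and to its opposite, makes the
    kernel trivial. *)
Lemma laplacian_shift_unitmx (R : realType) (n : nat) (L : 'M[R]_n) (d : R) :
  laplacian L -> 0 < d -> L + d%:M \in unitmx.
Proof.
move=> hL d0; rewrite -unitmx_tr -row_free_unit; apply: inj_row_free => u.
move=> /(congr1 trmx); rewrite trmx_mul trmxK trmx0 => u0.
have le0 (x : 'cV[R]_n) : (L + d%:M) *m x = 0 -> forall i, x i 0 <= 0.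
  move=> x0 i; rewrite -(pmulr_rle0 _ d0).
  by apply: (laplacian_shift_max hL d0) => j; rewrite x0 mxE.
apply/rowP => i; rewrite mxE; apply/eqP; rewrite eq_le.
have := le0 _ u0 i; rewrite mxE => -> /=.
have : (- u^T) i 0 <= 0 by apply: le0; rewrite mulmxN u0 oppr0.
by rewrite !mxE oppr_le0.
Qed.

(** * The scaled resolvent *)

(** This is [R_d]. For a Laplacian [L] and [d > 0], the factor [d] makes it fix the kernel of [L]
    and contract the sup norm. *)
Definition resolvent (R : realType) (n : nat) (L : 'M[R]_n) (d : R) : 'M[R]_n :=
  d *: invmx (L + d%:M).

Section Resolvent.
Variables (R : realType) (n : nat) (L : 'M[R]_n) (d : R).
Hypotheses (hL : laplacian L) (d0 : 0 < d).

Lemma mul_shift_resolvent : (L + d%:M) *m resolvent L d = d%:M.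
Proof.
by rewrite -scalemxAr mulmxV ?laplacian_shift_unitmx// scalemx1.
Qed.

Lemma mul_resolvent_shift : resolvent L d *m (L + d%:M) = d%:M.
Proof.
by rewrite -scalemxAl mulVmx ?laplacian_shift_unitmx// scalemx1.
Qed.

Lemma mul_resolvent_laplacian :
  resolvent L d *m L = d *: (1%:M - resolvent L d).
Proof.
have := mul_resolvent_shift.
rewrite mulmxDr mul_mx_scalar => /(canRL (addrK _)) ->.
by rewrite scalerBr scalemx1.
Qed.

Lemma mul_resolvent_ker (x : 'cV[R]_n) : L *m x = 0 -> resolvent L d *m x = x.
Proof.
move=> Lx; have := congr1 (mulmx^~ x) mul_resolvent_laplacian.
rewrite -mulmxA Lx mulmx0 -scalemxAl mulmxBl mul1mx => /esym/eqP.
by rewrite scaler_eq0 gt_eqF//= subr_eq0 => /eqP.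
Qed.

Lemma resolvent_le (x : 'cV[R]_n) (K : R) :
  (forall i, x i 0 <= K) -> forall i, (resolvent L d *m x) i 0 <= K.
Proof.
move=> xK i; rewrite -(ler_pM2l d0).
apply: (laplacian_shift_max hL d0) => j.
by rewrite mulmxA mul_shift_resolvent mul_scalar_mx mxE ler_pM2l.
Qed.

Lemma resolvent_norm_le (x : 'cV[R]_n) (K : R) :
  (forall i, `|x i 0| <= K) -> forall i, `|(resolvent L d *m x) i 0| <= K.
Proof.
move=> xK i; rewrite ler_norml lerNl; apply/andP; split.
  have := @resolvent_le (- x) K; rewrite mulmxN => /(_ _ i); rewrite mxE; apply.
  by move=> j; rewrite mxE (le_trans _ (xK j))// -normrN ler_norm.
by apply: resolvent_le => j; exact: le_trans (ler_norm _) (xK j).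
Qed.

(** Use [R_d L = d (I - R_d)]: the sum of absolute values bounds the entries of both [x] and
    [R_d x], whence the factor 2. *)
Lemma resolvent_range_norm_le (x : 'cV[R]_n) (i : 'I_n) :
  `|(resolvent L d *m (L *m x)) i 0| <= d * (2 * \sum_j `|x j 0|).
Proof.
have xK j : `|x j 0| <= \sum_j `|x j 0|.
  by rewrite (bigD1 j)//= lerDl sumr_ge0.
rewrite mulmxA mul_resolvent_laplacian -scalemxAl mulmxBl mul1mx mxE.
rewrite normrM gtr0_norm// ler_pM2l// mulr_natl mulr2n [in leLHS]mxE.
rewrite [X in _ + X]mxE (le_trans (ler_normB _ _))// lerD//.
exact: resolvent_norm_le.
Qed.

End Resolvent.

(** * Kernels of powers and convergence to the eigenprojection *)

(** Here [L x] lies in the kernel, so [R_d] fixes it, while [R_d L x] is [O(d)] with [d] arbitrarily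
    small. *)
Lemma laplacian_ker_sqr (R : realType) (n : nat) (L : 'M[R]_n) (x : 'cV[R]_n) :
  laplacian L -> L *m (L *m x) = 0 -> L *m x = 0.
Proof.
move=> hL LLx; apply/colP => i; rewrite [RHS]mxE; apply/eqP.
rewrite -normr_eq0 eq_le normr_ge0 andbT; apply/ler_addgt0Pr => e e0.
pose K := 2 * \sum_j `|x j 0|.
have K0 : 0 <= K by rewrite mulr_ge0// sumr_ge0.
(* The bound is used at [d = e / (K + 1)], where [d * K <= e]; the added 1 covers [K = 0]. *)
have d0 : 0 < e / (K + 1) by rewrite divr_gt0// ltr_wpDl.
have := resolvent_range_norm_le hL d0 x i.
rewrite (mul_resolvent_ker hL d0)// add0r -/K => /le_trans; apply.
by rewrite -mulrA ger_pMr// mulrC ler_pdivrMr ?mul1r ?lerDl// ltr_wpDl.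
Qed.

(** Valid for every exponent, 0 included, hence at the index of [L] without computing it. *)
Lemma laplacian_ker_pow (R : realType) (n : nat) (L : 'M[R]_n) (k : nat)
    (x : 'cV[R]_n) :
  laplacian L -> L ^+ k *m x = 0 -> L *m x = 0.
Proof.
move=> hL; elim: k x => [|k IH] x.
  by rewrite expr0 mul1mx => ->; rewrite mulmx0.
rewrite exprSr -mulmxA => /IH; exact: laplacian_ker_sqr.
Qed.

Lemma mul_laplacian_eigenproj (R : realType) (n : nat) (L : 'M[R]_n)
    (x : 'cV[R]_n) :
  laplacian L -> L *m (eigenproj L *m x) = 0.
Proof.
move=> hL; have [_ rJ _] := eigenprojP L.
have : mx_range (eigenproj L) (eigenproj L *m x) by exists x.
by rewrite rJ; exact: laplacian_ker_pow.
Qed.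

Lemma sub_eigenproj_range (R : realType) (n : nat) (A : 'M[R]_n)
    (x : 'cV[R]_n) :
  exists z, x - eigenproj A *m x = A *m z.
Proof.
have [JJ _ nJ] := eigenprojP A.
have : mx_null (eigenproj A) (x - eigenproj A *m x).
  by rewrite /mx_null /= mulmxBr mulmxA JJ subrr.
rewrite nJ /mx_index; case: ex_minnP => k /eqP rk _ [u _ <-].
(* Equal ranks make the column spaces of the two powers coincide, which exposes a leading factor [A]
   even when the index is 0. *)
have : ((A ^+ k)^T <= (A ^+ k.+1)^T)%MS.
  have sub : ((A ^+ k.+1)^T <= (A ^+ k)^T)%MS.
    by rewrite exprSr trmx_mul submxMl.
  by rewrite -(geq_leqif (mxrank_leqif_sup sub)) !mxrank_tr rk.
case/submxP => D /(congr1 trmx); rewrite trmx_mul !trmxK => ->.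
by exists (A ^+ k *m (D^T *m u)); rewrite !mulmxA exprS.
Qed.

(** Split [x = J x + L z] with [J] the eigenprojection: [R_d] fixes [J x], since [L J = 0], and
    sends [L z] to [O(d)]. *)
Lemma resolvent_cvg_eigenproj (R : realType) (n : nat) (L : 'M[R]_n)
    (x : 'cV[R]_n) (i : 'I_n) :
  laplacian L ->
  (resolvent L d *m x) i 0 @[d --> 0^'+] --> (eigenproj L *m x) i 0.
Proof.
move=> hL; have [z xz] := sub_eigenproj_range L x.
pose K := 2 * \sum_j `|z j 0|.
have dK : d * K @[d --> 0^'+] --> 0.
  rewrite -[X in _ --> X](mul0r K); apply: cvgM; last exact: cvg_cst.
  by apply: cvg_at_right_filter; exact: cvg_id.
apply/cvgrPdist_le => e e0.
near=> d.
have d0 : 0 < d by [].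
have -> : (resolvent L d *m x) i 0 =
    (eigenproj L *m x) i 0 + (resolvent L d *m (L *m z)) i 0.
  rewrite -[x in LHS](subrKC (eigenproj L *m x)) xz mulmxDr mxE.
  by rewrite (mul_resolvent_ker hL d0)// mul_laplacian_eigenproj.
rewrite opprD addrA subrr sub0r normrN.
apply: le_trans (resolvent_range_norm_le hL d0 z i) _.
rewrite -/K (le_trans (ler_norm _))//; near: d.
exact: cvgr0_norm_le dK _ e0.
Unshelve. all: by end_near. Qed.

(** * Coordinatewise limits, and conserved functionals of linear equations *)

Lemma cvg_mx_coord (R : realFieldType) (T : Type) (F : set_system T)
    (m n : nat) (f : T -> 'M[R]_(m, n)) (l : 'M[R]_(m, n)) :
  Filter F -> (forall i j, f x i j @[x --> F] --> l i j) ->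
  f x @[x --> F] --> l.
Proof.
move=> FF fl; apply/cvgrPdist_le => /= e e0; near=> x.
rewrite [leLHS]/Num.Def.normr/= mx_normrE (bigmax_le _ (ltW e0))//= => i _.
rewrite !mxE; move: i; near: x; apply: filter_forall => /= i.
exact: ((cvgrPdist_le _ _).1 (fl i.1 i.2)).
Unshelve. all: by end_near. Qed.

Lemma is_derive_mx_coord (R : realFieldType) (V : normedModType R) (m n : nat)
    (M : V -> 'M[R]_(m, n)) (t v : V) (l : 'M[R]_(m, n)) i j :
  is_derive t v M l -> is_derive t v (fun x => M x i j) (l i j).
Proof.
move=> [dM <-]; split; first by move: i j; apply/derivable_mxP.
by rewrite derive_mx// mxE.
Qed.

Section LinearODE.
Variables (R : realType) (m : nat) (A : 'M[R]_m) (y0 : 'cV[R]_m).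
Variable y : R -> 'cV[R]_m.
Hypothesis hy : linear_ode_solution A y0 y.

(** Right continuity at 0 follows from the right-hand derivative: [y h] is [y 0] plus [h] times a
    convergent quotient. *)
Lemma ode_right_cvg0 i : y t i 0 @[t --> 0^'+] --> y 0 i 0.
Proof.
have [_ dy0 _] := hy.
apply: (cvg_comp (G := nbhs (y 0)) y (fun M : 'cV[R]_m => M i 0)); last first.
  exact: coord_continuous.
have h0 : h @[h --> 0^'+] --> (0 : R).
  by apply: cvg_at_right_filter; exact: cvg_id.
have : h *: (h^-1 *: (y h - y 0)) + y 0 @[h --> 0^'+] --> 0 *: (A *m y 0) + y 0.
  by apply: cvgD; [exact: cvgZ | exact: cvg_cst].
rewrite scale0r add0r; apply: cvg_trans; apply: near_eq_cvg; near=> h.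
by rewrite scalerA divff ?scale1r ?subrK.
Unshelve. all: by end_near. Qed.

(** The derivative [w A y] vanishes, so the maximum principle applies to a family with a single
    member; taking [- w] gives the reverse inequality. *)
Lemma ode_functional_le (w : 'rV[R]_m) (t : R) :
  w *m A = 0 -> 0 <= t -> (w *m y t) 0 0 <= (w *m y0) 0 0.
Proof.
move=> wA t0; have [yy0 _ dy] := hy.
have wE u : (w *m y u) 0 0 = (\sum_i (w 0 i \*: (fun u => y u i 0))) u.
  by rewrite mxE fct_sumE.
rewrite -yy0.
apply: (@argmax_decreasing_le R unit (fun=> fun u => (w *m y u) 0 0)
  (fun=> fun=> 0)) => //.
- move=> _; rewrite mxE; under eq_cvg do rewrite mxE.
  apply: cvg_big => [|i _]; first exact: add_continuous.
  by apply: cvgM; [exact: cvg_cst | exact: ode_right_cvg0].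
- move=> _ x x0; rewrite (_ : (fun u => _) =
    \sum_i (w 0 i \*: (fun u => y u i 0))); last exact/funext/wE.
  have wAy : (w *m (A *m y x)) 0 0 = 0 by rewrite mulmxA wA mul0mx mxE.
  rewrite mxE in wAy; rewrite -[X in is_derive _ _ _ X]wAy.
  apply: is_derive_sum => i; apply: is_deriveZ.
  exact: is_derive_mx_coord (dy x x0).
Qed.

Lemma ode_conserved (w : 'rV[R]_m) (t : R) :
  w *m A = 0 -> 0 <= t -> (w *m y t) 0 0 = (w *m y0) 0 0.
Proof.
move=> wA t0; apply/eqP; rewrite eq_le ode_functional_le//=.
have := @ode_functional_le (- w) t; rewrite !mulNmx wA oppr0 => /(_ erefl t0).
by rewrite [leLHS]mxE [leRHS]mxE lerN2.
Qed.

End LinearODE.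

(** * Contraction of the spread *)

Lemma mul_HI_mx (R : realType) (n : nat) (x : 'cV[R]_(n + 1)) (i : 'I_(n + 1)) :
  (HI_mx R n *m x) i 0 = x i 0 - x (rshift n 0) 0.
Proof.
rewrite -[x in LHS]vsubmxK /HI_mx mul_block_col !mul0mx addr0 mul1mx mulNmx.
case: (split_ordP i) => j ->.
  by rewrite col_mxEu !mxE big_ord1 !mxE mul1r.
by rewrite col_mxEd mxE ord1 subrr.
Qed.

Lemma laplacian_L0_Hv (R : realType) (n : nat) (L : 'M[R]_n) (v : 'cV[R]_n) :
  laplacian L -> (forall i, 0 <= v i 0) -> laplacian (L0_mx L + Hv_mx v).
Proof.
move=> [L_le0 L0] v0; rewrite /L0_mx /Hv_mx add_block_mx !(add0r, addr0).
split=> [i j|i].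
  case: (split_ordP i) => k ->; case: (split_ordP j) => l -> ne.
  - by rewrite block_mxEul L_le0//; apply: contra_neq ne => ->.
  - by rewrite block_mxEur mxE.
  - by rewrite block_mxEdl !mxE ord1 oppr_le0.
  - by move: ne; rewrite !ord1 eqxx.
rewrite big_split_ord big_ord1 /=; case: (split_ordP i) => k ->.
  under eq_bigr do rewrite block_mxEul.
  by rewrite L0 block_mxEur mxE addr0.
under eq_bigr do rewrite block_mxEdl !mxE.
by rewrite block_mxEdr mxE !ord1 eqxx sumrN addrC subrr.
Qed.

(* [HI_mx] relaxes every node towards the last one, so it alone contracts the
   spread at rate exactly [d]; the Laplacian part cannot increase it. *)
Lemma spread_decay (R : realType) (n : nat) (d : R) (M : 'M[R]_(n + 1))
    (y0 : 'cV[R]_(n + 1)) (y : R -> 'cV[R]_(n + 1)) :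
  0 < d -> laplacian M -> linear_ode_solution (- (d *: HI_mx R n + M)) y0 y ->
  exists C, forall t : R, 0 <= t ->
    forall i j, `|y t i 0 - y t j 0| <= C * expR (- (d * t)).
Proof.
move=> d0 hM hy; have [yy0 _ dy] := hy.
set A := - (_ + _) in hy dy.
pose p (ij : 'I_(n + 1) * 'I_(n + 1)) t := y t ij.1 0 - y t ij.2 0.
pose f ij t := expR (d * t) * p ij t.
pose df ij t := expR (d * t) * (d * p ij t +
  ((A *m y t) ij.1 0 - (A *m y t) ij.2 0)).
pose C := \sum_ij `|f ij 0|.
have expdt (t : R) : 0 < t ->
    is_derive t 1 (fun u => expR (d * u)) (d * expR (d * t)).
  move=> t0; have -> : (fun u => expR (d * u)) = expR \o (d \*: (@id R)) by [].
  by apply: is_derive_eq; rewrite [_%:A]mulr1 mulrC.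
have fC ij (t : R) : 0 <= t -> f ij t <= C.
  move: ij t; apply: (argmax_decreasing_le (df := df)).
  - move=> ij; rewrite /f; apply: cvgM.
      apply: cvg_at_right_filter.
      apply: (continuous_comp (f := *%R d) (g := expR)).
        exact: mulrl_continuous.
      exact: continuous_expR.
    by apply: cvgB; exact: ode_right_cvg0 hy _.
  - move=> ij t t0.
    have -> : f ij = (fun u => expR (d * u)) *
        ((fun u => y u ij.1 0) - (fun u => y u ij.2 0)) by [].
    have e1 := expdt t t0.
    have e2 := is_derive_mx_coord ij.1 0 (dy t t0).
    have e3 := is_derive_mx_coord ij.2 0 (dy t t0).
    apply: is_derive_eq; rewrite /df.
    transitivity (expR (d * t) * ((A *m y t) ij.1 0 - (A *m y t) ij.2 0) +
      p ij t * (d * expR (d * t))) => //; ring.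
  - move=> [i j] t t0 fmax; apply: mulr_ge0_le0; first exact: expR_ge0.
    have pmax k l : p (k, l) t <= p (i, j) t.
      by rewrite -(ler_pM2l (expR_gt0 (d * t))); exact: fmax.
    (* At an extremal pair [i] maximises the entries of [y t] and [j] minimises them; the latter is
       treated through [- y t]. *)
    have iM : 0 <= (M *m y t) i 0.
      apply: laplacian_mul_argmax => // k; have := pmax k j.
      by rewrite /p/= lerD2r.
    have jM : 0 <= (M *m - y t) j 0.
      apply: laplacian_mul_argmax => // k; have := pmax i k.
      by rewrite /p/= lerD2l !mxE.
    have AE k : (A *m y t) k 0 =
        - (d * (y t k 0 - y t (rshift n 0) 0) + (M *m y t) k 0).
      rewrite -mul_HI_mx /A mulNmx mulmxDl -scalemxAl.
      by rewrite [LHS]mxE [in LHS]mxE [X in - (X + _)]mxE.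
    (* The terms of the last node cancel in the difference, and [- d (y_i - y_j)] offsets the
       derivative of the exponential weight. *)
    rewrite !AE /p/=; move: jM; rewrite mulmxN [leRHS]mxE; lra.
  - move=> ij; apply: le_trans (ler_norm _) _.
    by rewrite /C (bigD1 ij)//= lerDl sumr_ge0.
exists C => t t0 i j.
rewrite expRN ler_pdivlMr ?expR_gt0// mulrC.
have [_|_] := ler0P (y t i 0 - y t j 0); last exact: fC (i, j) t t0.
by rewrite opprB; exact: fC (j, i) t t0.
Qed.

(** * Null weights and the limit in time *)

(* The left null vector of [L0_mx L + Hdv_mx d v] with entries summing to 1. *)
Definition null_weights (R : realType) (n : nat) (L : 'M[R]_n) (d : R)
    (v : 'cV[R]_n) : 'rV[R]_(n + 1) :=
  row_mx ((d + vsum v)^-1 *: (v^T *m resolvent L d)) (d / (d + vsum v))%:M.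

Lemma mul_tr_const1 (R : realType) (n : nat) (v : 'cV[R]_n) :
  v^T *m const_mx 1 = ((vsum v)%:M : 'M[R]_1).
Proof.
apply/matrixP => i j; rewrite !ord1 !mxE eqxx mulr1n.
by apply: eq_bigr => k _; rewrite !mxE mulr1.
Qed.

Lemma mul_laplacian_const1 (R : realType) (n : nat) (L : 'M[R]_n) :
  laplacian L -> L *m (const_mx 1 : 'cV[R]_n) = 0.
Proof.
move=> [_ L0]; apply/colP => i; rewrite !mxE -[RHS](L0 i).
by apply: eq_bigr => j _; rewrite mxE mulr1.
Qed.

Section NullWeights.
Variables (R : realType) (n : nat) (L : 'M[R]_n) (d : R) (v : 'cV[R]_n).
Hypotheses (hL : laplacian L) (d0 : 0 < d) (v0 : forall i, 0 <= v i 0).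

Let s_ge0 : 0 <= vsum v. Proof. exact: sumr_ge0. Qed.

Let ds_neq0 : d + vsum v != 0. Proof. by rewrite gt_eqF// ltr_pwDl. Qed.

(** The all-ones vector is in the kernel of [L], so [R_d] fixes it and the total weight of [v] is
    preserved. *)
Lemma mul_tr_resolvent_const1 :
  v^T *m resolvent L d *m const_mx 1 = ((vsum v)%:M : 'M[R]_1).
Proof.
by rewrite -mulmxA mul_resolvent_ker// ?mul_tr_const1// mul_laplacian_const1.
Qed.

Lemma null_weights_mul : null_weights L d v *m (L0_mx L + Hdv_mx d v) = 0.
Proof.
rewrite /null_weights /L0_mx /Hdv_mx /HI_mx /Hv_mx scale_block_mx !add_block_mx.
rewrite !(addr0, add0r, scaler0) mul_row_block scalemx1.
rewrite -!scalemxAl -mulmxA mul_resolvent_shift// mul_mx_scalar mul_scalar_mx.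
rewrite -scalemxAr mulmxN mul_tr_resolvent_const1 -scalar_mxM.
rewrite !scalerN !scale_scalar_mx !scalerA mulrC subrr.
by rewrite mulrCA mulrA addNr row_mx0.
Qed.

Lemma null_weights_sum : \sum_i null_weights L d v 0 i = 1.
Proof.
have -> : \sum_i null_weights L d v 0 i =
    (null_weights L d v *m (const_mx 1 : 'cV_(n + 1))) 0 0.
  by rewrite mxE; apply: eq_bigr => i _; rewrite [const_mx _ _ _]mxE mulr1.
rewrite -col_mx_const /null_weights mul_row_col -scalemxAl.
rewrite mul_tr_resolvent_const1 mul_scalar_mx !mxE eqxx. rewrite mulr1n mulr1.
by rewrite [_^-1 * _]mulrC -mulrDl addrC divff.
Qed.

(** As [w y] is conserved and [w] sums to 1, [w y(0) - y_i(t)] is the [w]-weighted sum of the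
    [y_k(t) - y_i(t)], which decay exponentially. *)
Lemma leader_ode_cvg (y0 : 'cV[R]_(n + 1)) (y : R -> 'cV[R]_(n + 1)) :
  linear_ode_solution (- (L0_mx L + Hdv_mx d v)) y0 y ->
  y t @[t --> +oo] --> const_mx ((null_weights L d v *m y0) 0 0).
Proof.
move=> hy; set w := null_weights L d v.
have [|C hC] := @spread_decay _ _ d (L0_mx L + Hv_mx v) y0 y d0
  (laplacian_L0_Hv hL v0).
  by rewrite addrCA.
apply: cvg_mx_coord => i j; rewrite ord1 mxE.
pose K := (\sum_k `|w 0 k|) * C.
have Kexp : K * expR (- (d * t)) @[t --> +oo] --> 0.
  rewrite -[X in _ --> X](mulr0 K); apply: cvgM; first exact: cvg_cst.
  apply: (cvg_comp (G := +oo) (fun t => d * t) (fun u => expR (- u))).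
    exact: gt0_cvgMry.
  exact: cvgr_expR.
apply/cvgrPdist_le => e e0; near=> t.
have t0 : 0 <= t by near: t; exact: nbhs_pinfty_ge.
apply: (@le_trans _ _ (K * expR (- (d * t)))); last first.
  apply: le_trans (ler_norm _) _; near: t; exact: cvgr0_norm_le Kexp _ e0.
rewrite -(ode_conserved hy _ t0) ?mulmxN ?null_weights_mul ?oppr0//.
rewrite -[y t i 0]mul1r -null_weights_sum mxE mulr_suml -sumrB.
rewrite /K mulr_suml mulr_suml (le_trans (ler_norm_sum _ _ _))//.
apply: ler_sum => k _; rewrite -mulrBr normrM -mulrA.
by rewrite ler_wpM2l// hC.
Unshelve. all: by end_near. Qed.

End NullWeights.

(** * The limit as [d] tends to 0 *)

Lemma mul_const1_row (R : realType) (m k : nat) (w : 'rV[R]_k) (x : 'cV[R]_k) :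
  (const_mx 1 : 'cV[R]_m) *m w *m x = const_mx ((w *m x) 0 0).
Proof.
by apply/colP => i; rewrite -mulmxA mxE big_ord1 [in LHS]mxE mul1r [RHS]mxE.
Qed.

Lemma null_weights_mulE (R : realType) (n : nat) (L : 'M[R]_n) (d : R)
    (v a : 'cV[R]_n) (b : 'cV[R]_1) :
  (null_weights L d v *m col_mx a b) 0 0 = (d + vsum v)^-1 *
    (\sum_i v i 0 * (resolvent L d *m a) i 0 + d * b 0 0).
Proof.
rewrite /null_weights mul_row_col mul_scalar_mx.
rewrite -(scalemxAl _ (v^T *m _)) -mulmxA [LHS]mxE.
rewrite [X in X + _ = _]mxE [X in _ + X = _]mxE [(v^T *m _) 0 0]mxE mulrDr.
rewrite [d / _]mulrC -mulrA; congr (_ * _ + _).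
by apply: eq_bigr => i _; rewrite [v^T _ _]mxE.
Qed.

Lemma null_weights_cvg (R : realType) (n : nat) (L : 'M[R]_n)
    (v : R -> 'cV[R]_n) (vt : 'cV[R]_n) (y0 : 'cV[R]_(n + 1)) :
  laplacian L ->
  d / vsum (v d) @[d --> 0^'+] --> 0^'+ ->
  (vsum (v d))^-1 *: v d @[d --> 0^'+] --> vt ->
  (null_weights L d (v d) *m y0) 0 0 @[d --> 0^'+] -->
    (row_mx (vt^T *m eigenproj L) 0 *m y0) 0 0.
Proof.
move=> hL hs hvt; rewrite -[y0]vsubmxK; set a := usubmx y0; set b := dsubmx y0.
have ds0 : d / vsum (v d) @[d --> 0^'+] --> 0.
  by apply: cvg_trans hs _; exact: cvg_at_right_filter cvg_id.
have vcvg i : (vsum (v d))^-1 * v d i 0 @[d --> 0^'+] --> vt i 0.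
  have : ((vsum (v d))^-1 *: v d) i 0 @[d --> 0^'+] --> vt i 0.
    apply: (cvg_comp _ (fun M : 'cV[R]_n => M i 0) hvt).
    exact: coord_continuous.
  by under eq_cvg do rewrite mxE.
(* Numerator and denominator are divided by [s], so that only [d / s], [v / s] and [R_d a] remain,
   whose limits are known. *)
pose c d := (1 + d / vsum (v d))^-1 *
  (\sum_i (vsum (v d))^-1 * v d i 0 * (resolvent L d *m a) i 0 +
   d / vsum (v d) * b 0 0).
have : c d @[d --> 0^'+] -->
    (1 + 0)^-1 * (\sum_i vt i 0 * (eigenproj L *m a) i 0 + 0 * b 0 0).
  apply: cvgM.
    apply: cvgV; first by rewrite addr0.
    by apply: cvgD => //; exact: cvg_cst.
  apply: cvgD; last by apply: cvgM => //; exact: cvg_cst.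
  apply: cvg_big => [|i _]; first exact: add_continuous.
  by apply: cvgM => //; exact: resolvent_cvg_eigenproj.
rewrite addr0 invr1 mul1r mul0r addr0.
have -> : (row_mx (vt^T *m eigenproj L) 0 *m col_mx a b) 0 0 =
    \sum_i vt i 0 * (eigenproj L *m a) i 0.
  rewrite mul_row_col mul0mx addr0 -mulmxA mxE.
  by apply: eq_bigr => i _; rewrite mxE.
apply: cvg_trans; apply: near_eq_cvg; near=> d.
have d0 : 0 < d by [].
(* Convergence to [0^'+] makes [d / s] eventually positive; this excludes [s = 0], where the
   quotient takes the default value 0. *)
have dsp : 0 < d / vsum (v d).
  by near: d; exact: (hs _ (nbhs_right_gt 0)).
have s0 : 0 < vsum (v d).
  by move: dsp; rewrite pmulr_rgt0// invr_gt0.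
rewrite /c null_weights_mulE.
have -> : d + vsum (v d) = (1 + d / vsum (v d)) * vsum (v d).
  by rewrite mulrDl mul1r divfK ?gt_eqF// addrC.
rewrite invfM -[RHS]mulrA; congr (_ * _).
rewrite mulrDr mulr_sumr; congr (_ + _).
  by apply: eq_bigr => i _; rewrite mulrA.
by rewrite mulrA [_^-1 * d]mulrC.
Unshelve. all: by end_near. Qed.

Theorem theorem2 (R : realType) (n : nat) (L : 'M[R]_n)
    (v : R -> 'cV[R]_n) (vt : 'cV[R]_n)
    (y0 : 'cV[R]_(n + 1)) (y : R -> R -> 'cV[R]_(n + 1))
    (hL : laplacian L)
    (hv : forall d : R, 0 < d -> forall i, 0 <= v d i 0)
    (hs : d / vsum (v d) @[d --> 0^'+] --> 0^'+)
    (hvt : (vsum (v d))^-1 *: v d @[d --> 0^'+] --> vt)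
    (hy : forall d : R, 0 < d ->
        linear_ode_solution (- (L0_mx L + Hdv_mx d (v d))) y0 (y d)) :
  let J := eigenproj L in
  [/\ forall d : R, 0 < d -> cvg (y d t @[t --> +oo]),
      lim (y d t @[t --> +oo]) @[d --> 0^'+] -->
        (const_mx 1 : 'cV[R]_(n + 1)) *m row_mx (vt^T *m J) 0 *m y0 &
      (forall d : R, 0 < d -> v d = (vsum (v d) / n%:R) *: const_mx 1) ->
        lim (y d t @[t --> +oo]) @[d --> 0^'+] -->
          (const_mx 1 : 'cV[R]_(n + 1)) *m
            row_mx (n%:R^-1 *: (const_mx 1 : 'rV[R]_n) *m J) 0 *m y0
        /\ (const_mx 1 : 'cV[R]_(n + 1)) *m
            row_mx (n%:R^-1 *: (const_mx 1 : 'rV[R]_n) *m J) 0 *m y0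
           = (n%:R^-1 * \sum_(j < n) (\sum_(i < n) J i j) * y0 (lshift 1 j) 0)
             *: const_mx 1].
Proof.
move=> J.
have hw d (d0 : 0 < d) := leader_ode_cvg hL d0 (hv d d0) (hy d d0).
have main : lim (y d t @[t --> +oo]) @[d --> 0^'+] -->
    (const_mx 1 : 'cV[R]_(n + 1)) *m row_mx (vt^T *m J) 0 *m y0.
  rewrite mul_const1_row.
  have : const_mx ((null_weights L d (v d) *m y0) 0 0) @[d --> 0^'+] -->
      (const_mx ((row_mx (vt^T *m J) 0 *m y0) 0 0) : 'cV[R]_(n + 1)).
    apply: cvg_mx_coord => i j; rewrite mxE; under eq_cvg do rewrite mxE.
    exact: null_weights_cvg.
  apply: cvg_trans; apply: near_eq_cvg; near=> d.
  have d0 : 0 < d by [].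
  by apply/esym/cvg_lim => //; exact: hw.
split=> //.
  by move=> d d0; apply/cvg_ex; eexists; exact: hw.
move=> hvn.
(* For uniform [v] the vector [v / s] is eventually constant, so uniqueness of limits determines
   [vt] and reduces the claim to [main]. *)
have vtE : vt^T = n%:R^-1 *: (const_mx 1 : 'rV[R]_n).
  have : (vsum (v d))^-1 *: v d @[d --> 0^'+] -->
      n%:R^-1 *: (const_mx 1 : 'cV[R]_n).
    apply: (@cvg_trans _ ((fun=> n%:R^-1 *: const_mx 1) @ 0^'+)); last first.
      exact: cvg_cst.
    apply: near_eq_cvg; near=> d.
    have d0 : 0 < d by [].
    have dsp : 0 < d / vsum (v d).
      by near: d; exact: (hs _ (nbhs_right_gt 0)).
    have s0 : vsum (v d) != 0.
      by apply: contraTneq dsp => ->; rewrite invr0 mulr0 ltxx.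
    have /= -> := congr1 (fun u => (vsum (v d))^-1 *: u) (hvn d d0).
    by rewrite scalerA mulKf.
  move=> /(cvg_lim (@norm_hausdorff _ _)).
  rewrite (cvg_lim (@norm_hausdorff _ _) hvt) => ->.
  by rewrite linearZ/= trmx_const.
rewrite -vtE; split=> //.
rewrite mul_const1_row; apply/colP => i.
rewrite [LHS]mxE [RHS]mxE [X in _ = _ * X]mxE mulr1.
rewrite -[y0 in LHS]vsubmxK mul_row_col mul0mx addr0 mxE mulr_sumr.
apply: eq_bigr => j _; rewrite vtE -scalemxAl [X in X * _]mxE -[LHS]mulrA.
congr (_ * (_ * _)); last by rewrite mxE.
by rewrite mxE; apply: eq_bigr => k _; rewrite mxE mul1r.
Unshelve. all: by end_near. Qed.
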